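(* Let $\mathcal{P}=\{\mathbb{P}_{\boldsymbol\theta}:\boldsymbol\theta\in\boldsymbol\Theta\}$ with $\boldsymbol\Theta\subseteq\mathbb{R}^p$ be a parametric family and $\mathcal{M}$ an estimation scheme satisfying the uniform tail assumption (stated in the context) with constants $C_1,C_2,\gamma>0$ and $r(n)=n^\kappa$, where $\kappa\ge\gamma/2$, and also the unbiasedness assumption (stated in the context). Let $s>0$ and $c_t=t^{1+s}$ for $t\ge1$. Let $(\widehat{\boldsymbol\theta}_t)_{t\ge1}$ be the recursive training process (defined in the context) with ground truth $\boldsymbol\theta^\star\in\boldsymbol\Theta$, initial sample size $n$ and schedule $(c_t)_{t\ge1}$. Then for every $\delta>0$, $$\lim_{n\to\infty}\lim_{T\to\infty}\mathbb{P}\big(\|\widehat{\boldsymbol\theta}_T-\boldsymbol\theta^\star\|_2\ge\delta\big)=0.$$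
   Context: Estimation scheme: $\mathcal{M}$ maps any finite dataset of points of the sample space $\mathcal{X}$ to an element of $\boldsymbol\Theta$. Recursive (fully synthetic) training: $\mathcal{D}_0$ consists of $n_0=n$ i.i.d. draws from $\mathbb{P}_{\boldsymbol\theta^\star}$; $\widehat{\boldsymbol\theta}_{t+1}=\mathcal{M}(\mathcal{D}_t)$ for all $t\ge0$; and for $t\ge1$, conditionally on the past, $\mathcal{D}_t$ consists of $n_t=c_t\, n$ i.i.d. draws from $\mathbb{P}_{\widehat{\boldsymbol\theta}_t}$ (if $c_tn$ is not an integer, $n_t=\lceil c_tn\rceil$). Uniform tail assumption: there are constants $C_1,C_2,\gamma>0$ and a positive diverging sequence $r(n)$ such that for all $n\ge1$ and all $\delta>0$, $$\sup_{\boldsymbol\theta\in\boldsymbol\Theta}\mathbb{P}\big(\|\widehat{\boldsymbol\theta}-\boldsymbol\theta\|_2\ge\delta\big)\le C_1\exp(-C_2\,r(n)\,\delta^\gamma),$$ where $\widehat{\boldsymbol\theta}=\mathcal{M}(\mathcal{D})$ and $\mathcal{D}$ consists of $n$ i.i.d. draws from $\mathbb{P}_{\boldsymbol\theta}$. Unbiasedness assumption: for every $\boldsymbol\theta\in\boldsymbol\Theta$, every $n\ge1$ and $\mathcal{D}$ consisting of $n$ i.i.d. draws from $\mathbb{P}_{\boldsymbol\theta}$, $\mathbb{E}(\mathcal{M}(\mathcal{D}))=\boldsymbol\theta$.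
   Formalization: The inner limit over T is replaced by the limit superior over T, because under the stated assumptions the inner limit need not exist for every δ; wherever it exists, the two agree. *)

(* Defs.v *)
From HB Require Import structures.
From mathcomp Require Import all_boot all_order all_algebra.
From mathcomp Require Import all_classical all_reals all_analysis.
From mathcomp Require Import measurable_realfun.

Set Implicit Arguments.
Unset Strict Implicit.
Unset Printing Implicit Defensive.

Import Order.TTheory GRing.Theory Num.Theory.
Import numFieldNormedType.Exports.

Local Open Scope classical_set_scope.
Local Open Scope ring_scope.

(* The library norm on ['rV[R]_p] is the sup norm. *)
Definition norm2 (R : realType) (p : nat) (v : 'rV[R]_p) : R :=
  Num.sqrt (\sum_(i < p) v 0 i ^+ 2).

Section iid_law.
Context (d : measure_display) (X : measurableType d) (R : realType).

Definition tcons (n : nat) (x : X * n.-tuple X) : n.+1.-tuple X :=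
  [tuple of x.1 :: x.2].

Lemma measurable_tcons n : measurable_fun setT (@tcons n).
Proof. by apply: measurable_cons; [exact: measurable_fst|exact: measurable_snd]. Qed.

HB.instance Definition _ (n : nat) :=
  isMeasurableFun.Build _ _ _ _ (@tcons n) (@measurable_tcons n).

(* The n-fold product Q^{(x) n}, i.e. the joint law of n i.i.d. draws from Q;
   [iid_lawE] below characterizes it on rectangles. *)
Fixpoint iid_law (Q : probability X R) (n : nat) : probability (n.-tuple X) R :=
  match n return probability (n.-tuple X) R with
  | 0%N => dirac [tuple]
  | m.+1 => distribution (Q \x iid_law Q m)%E (@tcons m)
  end.

Lemma measurable_rectangle n (B : 'I_n -> set X) :
  (forall i, measurable (B i)) ->
  measurable [set x : n.-tuple X | forall i, B i (tnth x i)].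
Proof.
move=> mB.
rewrite (_ : [set _ | _] =
    \bigcap_(i in [set: 'I_n]) ((@tnth n X)^~ i @^-1` B i)); last first.
  by apply/seteqP; split=> [x Bx i _|x Bx i]; [exact: Bx|exact: (Bx i I)].
apply: fin_bigcap_measurable => [|i _]; first exact: finite_finset.
by rewrite -[X in measurable X]setTI; exact: (measurable_tnth i measurableT (mB i)).
Qed.

Lemma iid_lawE (Q : probability X R) n (B : 'I_n -> set X) :
  (forall i, measurable (B i)) ->
  iid_law Q n [set x | forall i, B i (tnth x i)] = (\prod_(i < n) Q (B i))%E.
Proof.
elim: n B => [|n IHn] B mB.
  rewrite big_ord0 /= diracE (_ : _ \in _ = true) //.
  by apply/mem_set => -[].
rewrite big_ord_recl -(IHn (fun i => B (lift ord0 i))) //=.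
rewrite -product_measure1E //; last first.
  exact: (measurable_rectangle (fun i => mB (lift ord0 i))).
congr (_ _); apply/seteqP; split=> -[x y] /=.
  move=> Bxy; split; first by have := Bxy ord0; rewrite tnth0.
  by move=> i; have := Bxy (lift ord0 i); rewrite tnthS.
move=> [Bx By] i; case: (unliftP ord0 i) => [j|] ->; first by rewrite tnthS.
by rewrite tnth0.
Qed.

End iid_law.

Section estimation_scheme.
Context (R : realType) (p : nat) (d : measure_display) (X : measurableType d).
Variables (Theta : set 'rV[R]_p) (P : 'rV[R]_p -> probability X R).

(* R^p carries its Borel sigma-algebra, so that measurability of [M] is
   measurability of each of its coordinates. *)
Definition estimation_scheme (M : seq X -> 'rV[R]_p) : Prop :=
  (forall D : seq X, Theta (M D)) /\
  (forall (m : nat) (i : 'I_p),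
    measurable_fun setT (fun D : m.-tuple X => M D 0 i)).

Variable M : seq X -> 'rV[R]_p.

Definition uniform_tail (C1 C2 gamma : R) (r : nat -> R) : Prop :=
  [/\ 0 < C1, 0 < C2, 0 < gamma,
      (forall n, (0 < n)%N -> 0 < r n) /\ r @ \oo --> +oo
    & forall (n : nat) (delta : R), (0 < n)%N -> 0 < delta ->
      (ereal_sup [set iid_law (P theta) n
                        [set D | (delta <= norm2 (M D - theta))%R]
                 | theta in Theta]
       <= (C1 * expR (- (C2 * r n * delta `^ gamma)))%:E)%E].

Definition unbiased : Prop :=
  forall theta, Theta theta -> forall n : nat, (0 < n)%N ->
  forall i : 'I_p,
    ('E_(iid_law (P theta) n)[(fun D => M D 0 i)%R] = (theta 0 i)%R%:E)%E.

End estimation_scheme.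

(* [f] is a version of the conditional probability of [A] given the
   sub-sigma-algebra [G]. *)
Definition is_cond_prob (R : realType) (d : measure_display)
    (Omega : measurableType d) (Pr : probability Omega R)
    (G : set (set Omega)) (A : set Omega) (f : Omega -> \bar R) : Prop :=
  (forall V : set (\bar R), measurable V -> G (f @^-1` V)) /\
  (forall E, G E -> (\int[Pr]_(w in E) f w = Pr (A `&` E))%E).

Section recursive_training.
Context (R : realType).

Definition sample_size (c : nat -> R) (n t : nat) : nat :=
  if t is 0%N then n else `|Num.ceil (c t * n%:R)|%N.

Context (p : nat) (d : measure_display) (X : measurableType d).
Variables (P : 'rV[R]_p -> probability X R) (M : seq X -> 'rV[R]_p).
Variables (theta_star : 'rV[R]_p) (c : nat -> R) (n : nat).
Context (dO : measure_display) (Omega : measurableType dO).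
Variable Pr : probability Omega R.
Variable D : forall t : nat, Omega -> (sample_size c n t).-tuple X.

(* sigma(D_0, ..., D_{t-1}), to which theta_1, ..., theta_t are adapted *)
Definition past (t : nat) : set (set Omega) :=
  <<s \bigcup_(u in [set u | (u < t)%N])
        preimage_set_system setT (@D u) measurable >>.

(* [theta 0] is unconstrained: the process of estimates starts at time 1. *)
Record recursive_training (theta : nat -> Omega -> 'rV[R]_p) : Prop := {
  training_measurable : forall t, measurable_fun setT (@D t);
  training_init : forall B : set ((sample_size c n 0).-tuple X), measurable B ->
    Pr (@D 0%N @^-1` B) = iid_law (P theta_star) (sample_size c n 0) B;
  training_estimate : forall t w, theta t.+1 w = M (D t w);
  training_step : forall t, (0 < t)%N ->
    forall B : set ((sample_size c n t).-tuple X), measurable B ->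
    is_cond_prob Pr (past t) (@D t @^-1` B)
      (fun w => iid_law (P (theta t w)) (sample_size c n t) B)
}.

End recursive_training.

(* Main.v *)
(* Let V_T = E |theta_T - theta_star|^2. Integrating the tail assumption bounds the
   mean squared error of M on m draws by K m^(-2 kappa / gamma) <= K / m,
   uniformly in the parameter. By unbiasedness, conditionally on theta_t the
   squared distance of theta_(t+1) to theta_star has mean |theta_t - theta_star|^2
   plus that squared error, so V_(t+1) <= V_t + K / n_t. Since
   sum_t t^-(1+s) <= 1 + 1/s, V_T <= (K / n) (2 + 1/s) for all T, and
   Chebyshev's inequality concludes. *)
Require Import Defs.
From mathcomp Require Import all_boot all_order all_algebra.
From mathcomp Require Import all_classical all_reals all_analysis.
From mathcomp Require Import measurable_realfun giry.
From mathcomp Require Import lra ring.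

Import Order.TTheory GRing.Theory Num.Theory.
Import numFieldNormedType.Exports.

Local Open Scope classical_set_scope.
Local Open Scope ring_scope.

(** * Bounds for the series of inverse powers *)

(** A discrete form of the derivative of [x^(-s)]. After division by [(t+1)^(-s)] it reads
    [1 + s/(t+1) <= (t/(t+1))^(-s)], and two uses of [1 + x <= expR x] suffice: one for the power,
    one for [ln (t/(t+1)) <= -1/(t+1)]. *)
Lemma powRN_telescope (R : realType) (s : R) (t : nat) : 0 < s -> (0 < t)%N ->
  s * (t.+1%:R `^ (1 + s))^-1 <= t%:R `^ (- s) - t.+1%:R `^ (- s).
Proof.
move=> s0 t0.
have tR : (0 : R) < t%:R by rewrite ltr0n.
have t1R : (0 : R) < t.+1%:R by rewrite ltr0n.
have pos : 0 < t.+1%:R `^ (- s) by exact: powR_gt0.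
have -> : s * (t.+1%:R `^ (1 + s))^-1 = t.+1%:R `^ (- s) * (s / t.+1%:R).
  have -> : t.+1%:R `^ (1 + s) = t.+1%:R * t.+1%:R `^ s :> R.
    by rewrite powRD ?powRr1 ?ler0n//; apply/implyP => _; rewrite gt_eqF.
  by rewrite powRN invfM; ring.
suff : t.+1%:R `^ (- s) * (1 + s / t.+1%:R) <= t%:R `^ (- s) by rewrite mulrDr mulr1 lerBrDl.
have -> : t%:R `^ (- s) = t.+1%:R `^ (- s) * (t%:R / t.+1%:R) `^ (- s).
  by rewrite -powRM ?divr_ge0 ?ler0n// mulrC divfK ?gt_eqF.
rewrite ler_pM2l//.
have q0 : 0 < t%:R / t.+1%:R :> R by rewrite divr_gt0.
rewrite /powR gt_eqF//; apply: le_trans (expR_ge1Dx _).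
rewrite lerD2l mulNr -mulrN ler_pM2l//.
suff : ln (t%:R / t.+1%:R) <= - t.+1%:R^-1 :> R by rewrite lerNr.
rewrite -ler_expR lnK ?posrE//; apply: le_trans (expR_ge1Dx _).
rewrite le_eqVlt; apply/orP; left; apply/eqP.
by rewrite -natr1; field; rewrite natr1 gt_eqF.
Qed.

Lemma sum_powRN_le (R : realType) (s : R) (N : nat) : 0 < s ->
  \sum_(1 <= t < N) (t%:R `^ (1 + s))^-1 <= 1 + s^-1.
Proof.
move=> s0.
(* The induction keeps the telescoped remainder [(k+1)^(-s)], without which the bound would not
   reproduce itself. The leading 1 is the term [t = 1]. *)
suff H k : \sum_(1 <= t < k.+2) (t%:R `^ (1 + s))^-1
    <= 1 + s^-1 * (1 - k.+1%:R `^ (- s)).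
  case: N => [|[|k]]; last 1 first.
  apply: le_trans (H k) _; rewrite lerD2l.
  by apply: ler_piMr; rewrite ?invr_ge0 ?(ltW s0)// lerBlDr lerDl powR_ge0.
  1,2: by rewrite big_geq// addr_ge0// invr_ge0 ltW.
elim: k => [|k IH]; first by rewrite big_nat1 !powR1 subrr mulr0 invr1 addr0.
rewrite big_nat_recr//=.
have := @powRN_telescope R s k.+1 s0 isT.
set y := (_ `^ (1 + s))^-1 => h.
have : y <= s^-1 * (k.+1%:R `^ (- s) - k.+2%:R `^ (- s)) by rewrite mulrC ler_pdivlMr// mulrC.
by move: IH; rewrite !mulrBr; lra.
Qed.

(** * Second moments from stretched-exponential tails *)

(** A single term [x^(m+1) / (m+1)!] of the exponential series, with [(m+1) g >= 3], bounds [expR x]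
    from below. The cube is chosen so that the weight [2 k + 1] still leaves the summable
    [k^(-2)]. *)
Lemma expRN_powR_le (R : realType) (C g : R) : 0 < C -> 0 < g ->
  exists2 K : R, 0 <= K & forall k : nat, (0 < k)%N ->
    expR (- (C * k%:R `^ g)) <= K / k%:R ^+ 3.
Proof.
move=> C0 g0.
have [m hm] : exists m : nat, 3 <= m.+1%:R * g.
  exists (Num.bound (3 / g)); rewrite -ler_pdivrMr//.
  have /archi_boundP/ltW/le_trans : 0 <= 3 / g by rewrite divr_ge0 ?(ltW g0).
  by apply; rewrite ler_nat.
exists (m.+1`!%:R / C ^+ m.+1); first by rewrite divr_ge0 ?ler0n// exprn_ge0// ltW.
move=> k k0.
have kR : (1 : R) <= k%:R by rewrite ler1n.
have k0R : (0 : R) < k%:R by rewrite ltr0n.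
have x0 : 0 < C * k%:R `^ g by rewrite mulr_gt0// powR_gt0.
have Ck : 0 < C ^+ m.+1 by exact: exprn_gt0.
have k3 : 0 < k%:R ^+ 3 :> R by exact: exprn_gt0.
rewrite expRN invf_ple ?posrE ?expR_gt0 ?divr_gt0 ?ltr0n ?fact_gt0//.
have h : (C * k%:R `^ g) ^+ m.+1 / m.+1`!%:R <= expR (C * k%:R `^ g).
  by apply: le_trans (expR_ge1Dxn m (ltW x0)); rewrite lerDr.
have e : k%:R ^+ 3 <= (k%:R `^ g) ^+ m.+1 :> R.
  by rewrite -!powR_mulrn ?powR_ge0 ?ler0n// -powRrM ler_powR// mulrC.
apply: le_trans h; rewrite !invf_div exprMn.
rewrite mulrA ler_pM2r ?invr_gt0 ?ltr0n ?fact_gt0//.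
by rewrite mulrC ler_pM2l.
Qed.

(* With m the integer part of Z, Z^2 < (m + 1)^2 = sum_(k <= m) (2 k + 1). *)
Lemma second_moment_le_tails (d : measure_display) (T : measurableType d)
    (R : realType) (mu : probability T R) (Z : T -> R) (a : nat -> R) (B : R) :
  measurable_fun setT Z -> (forall x, 0 <= Z x) ->
  (forall k, (0 < k)%N -> mu [set x | (k%:R <= Z x)%R] <= (a k)%:E)%E ->
  (forall N, \sum_(1 <= k < N) (2 * k%:R + 1) * a k <= B) ->
  (\int[mu]_x (Z x ^+ 2)%:E <= (1 + B)%:E)%E.
Proof.
move=> mZ Z0 ha hB.
have mA k : measurable [set x | k%:R <= Z x].
  by rewrite -[X in measurable X]setTI; exact: measurable_fun_le.
pose f k x : \bar R := ((2 * k%:R + 1) * \1_[set x | k%:R <= Z x] x)%:E.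
have f0 k x : (0 <= f k x)%E by rewrite lee_fin mulr_ge0 // addr_ge0// mulr_ge0.
have mf k : measurable_fun setT (f k).
  by apply/measurable_EFinP; apply: measurable_funM => //; exact: measurable_indic.
have B0 : 0 <= B by have := hB 0%N; rewrite big_geq.
apply: (@le_trans _ _ (\int[mu]_x \sum_(k <oo) f k x)%E).
  apply: ge0_le_integral => //.
  - by move=> x _; rewrite lee_fin sqr_ge0.
  - by apply/measurable_EFinP; exact: measurable_funX.
  - exact: ge0_emeasurable_sum.
  - move=> x _.
    pose m := Num.trunc (Z x).
    apply: le_trans (nneseries_lim_ge m.+1 _) => //.
    have -> : (\sum_(0 <= k < m.+1) f k x = (m.+1%:R ^+ 2)%:E)%E.
      rewrite /f sumEFin; congr EFin.
      rewrite (eq_big_nat _ _ (F2 := fun k => 2 * k%:R + 1)) => [|k /andP[_ km]].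
        elim: m.+1 => [|j IH]; first by rewrite big_geq// expr0n.
        by rewrite big_nat_recr//= IH -natr1; ring.
      rewrite indicE mem_set ?mulr1//= (@le_trans _ _ m%:R) ?ler_nat//.
      by rewrite truncn_le.
    by rewrite lee_fin lerXn2r ?nnegrE ?ler0n// ltW// truncnS_gt.
rewrite integral_nneseries//.
apply: lime_le => //; first by apply: is_cvg_nneseries => k _ _; exact: integral_ge0.
apply: nearW => N.
have If k : (\int[mu]_x f k x = (2 * k%:R + 1)%:E * mu [set x | (k%:R <= Z x)%R])%E.
  under eq_integral do rewrite /f EFinM.
  rewrite ge0_integralZl ?integral_indic ?setIT//.
  - by apply/measurable_EFinP; exact: measurable_indic.
under eq_bigr do rewrite If.
case: N => [|N]; first by rewrite big_geq// lee_fin addr_ge0.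
(* The term [k = 0] has weight 1 and a probability at most 1; it accounts for the 1 in [1 + B], and
   the tail bounds serve for [k >= 1]. *)
rewrite big_nat_recl// (EFinD 1 B); apply: leeD.
  by rewrite mulr0 add0r mul1e probability_le1.
apply: (@le_trans _ _ (\sum_(1 <= k < N.+1) ((2 * k%:R + 1) * a k)%:E)%E).
  rewrite big_add1 /=; apply: lee_sum => k _.
  by rewrite EFinM lee_wpmul2l// ?ha// lee_fin addr_ge0// mulr_ge0.
by rewrite sumEFin lee_fin.
Qed.

(** Rescaling to [a * N] removes [a] from the tail bound. [K] is fixed before the space and the
    measure, which later gives uniformity in the parameter and the sample size. *)
Lemma second_moment_stretched_tail (R : realType) (C1 C2 g : R) :
  0 < C1 -> 0 < C2 -> 0 < g ->
  exists2 K : R, 0 <= K & forall (d : measure_display) (T : measurableType d)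
      (mu : probability T R) (N : T -> R) (a : R),
    measurable_fun setT N -> (forall x, 0 <= N x) -> 0 < a ->
    (forall delta, 0 < delta ->
      (mu [set x | (delta <= N x)%R] <=
       (C1 * expR (- (C2 * a `^ g * delta `^ g)))%:E)%E) ->
    (\int[mu]_x (N x ^+ 2)%:E <= (K / a ^+ 2)%:E)%E.
Proof.
move=> C10 C20 g0; have [K0 K00 hK0] := @expRN_powR_le R C2 g C20 g0.
(* The 3 comes from [2 k + 1 <= 3 k], and [1 + 1^-1] bounds the sum of [k^(-2)] by [sum_powRN_le] at
   [s = 1]. *)
pose B := 3 * C1 * K0 * (1 + 1^-1).
have B0 : 0 <= B by rewrite !mulr_ge0 ?(ltW C10)// addr_ge0.
exists (1 + B); first by rewrite addr_ge0.
move=> d T mu N a mN N0 a0 tailN.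
have mN2 : measurable_fun setT (fun x => (N x ^+ 2)%:E).
  by apply/measurable_EFinP; exact: measurable_funX.
rewrite EFinM lee_pdivlMr ?exprn_gt0// muleC.
rewrite -ge0_integralZl//; last 2 first.
- by move=> x _; rewrite lee_fin sqr_ge0.
- by rewrite lee_fin exprn_ge0// ltW.
under eq_integral do rewrite -EFinM -exprMn.
apply: (@second_moment_le_tails _ _ _ _ _
  (fun k => C1 * expR (- (C2 * k%:R `^ g)))).
- exact: measurable_funM.
- by move=> x; rewrite mulr_ge0// ltW.
- move=> k k0; have := tailN (k%:R / a).
  rewrite divr_gt0 ?ltr0n// => /(_ isT).
  rewrite -mulrA -powRM ?divr_ge0 ?ler0n ?(ltW a0)//.
  rewrite (_ : a * (k%:R / a) = k%:R); last by rewrite mulrC divfK ?gt_eqF.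
  congr (_ <= _)%E; congr (mu _); apply/funext => x /=.
  by rewrite ler_pdivrMr// mulrC.
- move=> m; have := @sum_powRN_le R 1 m ltr01.
  move=> /(ler_wpM2l (_ : 0 <= 3 * C1 * K0)); rewrite !mulr_ge0 ?(ltW C10)//.
  move=> /(_ isT); apply: le_trans; rewrite mulr_sumr.
  rewrite big_nat_cond [leRHS]big_nat_cond; apply: ler_sum => k.
  rewrite andbT => /andP[k0 _].
  have kR : (1 : R) <= k%:R by rewrite ler1n.
  have -> : k%:R `^ (1 + 1) = k%:R ^+ 2 :> R by rewrite -powR_mulrn ?ler0n.
  apply: (@le_trans _ _ (3 * k%:R * (C1 * (K0 / k%:R ^+ 3)))).
    apply: ler_pM.
    + by rewrite addr_ge0// mulr_ge0.
    + by rewrite mulr_ge0 ?expR_ge0// ltW.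
    + by move: kR; lra.
    + by rewrite ler_pM2l// hK0.
  rewrite le_eqVlt; apply/orP; left; apply/eqP; field.
  by rewrite gt_eqF// ltr0n.
Qed.

(** * Integration against a conditional law *)

(** The tower property: the law of [Y] and the Giry bind of [mu] with the kernel [k] agree on
    measurable sets, so they integrate [h] alike. *)
Lemma integral_cond_law (d1 d2 : measure_display) (T1 : measurableType d1)
    (T2 : measurableType d2) (R : realType) (mu : probability T1 R)
    (Y : T1 -> T2) (k : T1 -> probability T2 R) (h : T2 -> \bar R) :
  measurable_fun setT Y ->
  (forall U, measurable U -> measurable_fun setT (fun w => k w U)) ->
  (forall U, measurable U -> mu (Y @^-1` U) = \int[mu]_w k w U)%E ->
  measurable_fun setT h -> (forall x, 0 <= h x)%E ->
  (\int[mu]_w h (Y w) = \int[mu]_w \int[k w]_x h x)%E.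
Proof.
move=> mY mk law_Y mh h0.
pose f : T1 -> giry T2 R := fun w => k w.
have mf : measurable_fun setT f by exact: measurable_giry_codensity.
rewrite -[LHS]/(giry_int (mu : giry T1 R) (h \o Y)) -(giry_int_map mY)//.
rewrite -[RHS]/(giry_int (mu : giry T1 R) (fun w => giry_int (f w) h)).
rewrite -(giry_int_bind _ mf)//; apply: eq_measure_integral => A mA _.
rewrite [LHS]law_Y//.
rewrite -[RHS]/(giry_int (giry_map mf (mu : giry T1 R)) (giry_ev ^~ A)).
by rewrite giry_int_map//; exact: measurable_giry_ev.
Qed.

(** * Euclidean norm and bias-variance decomposition *)

Lemma norm2_ge0 (R : realType) (p : nat) (v : 'rV[R]_p) : 0 <= norm2 v.
Proof. exact: sqrtr_ge0. Qed.

Lemma sqr_norm2 (R : realType) (p : nat) (v : 'rV[R]_p) :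
  norm2 v ^+ 2 = \sum_(i < p) v 0 i ^+ 2.
Proof. by rewrite sqr_sqrtr// sumr_ge0// => i _; exact: sqr_ge0. Qed.

Lemma sqr_entry_le_norm2 (R : realType) (p : nat) (v : 'rV[R]_p) (i : 'I_p) :
  v 0 i ^+ 2 <= norm2 v ^+ 2.
Proof.
by rewrite sqr_norm2 (bigD1 i)//= lerDl sumr_ge0// => j _; exact: sqr_ge0.
Qed.

Lemma measurable_norm2_dist (d : measure_display) (T : measurableType d)
    (R : realType) (p : nat) (F : T -> 'rV[R]_p) (a : 'rV[R]_p) :
  (forall i, measurable_fun setT (fun x => F x 0 i)) ->
  measurable_fun setT (fun x => norm2 (F x - a)).
Proof.
move=> mF; apply: measurableT_comp; first exact: (continuous_measurable_fun (@sqrt_continuous R)).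
apply: measurable_sum => i; under eq_fun do rewrite !mxE.
by apply: measurable_funX; exact: measurable_funB.
Qed.

(* Bias-variance: the cross term integrates to [0] because [theta] is the mean. *)
Lemma second_moment_shift_le (d : measure_display) (T : measurableType d)
    (R : realType) (mu : probability T R) (p : nat) (F : T -> 'rV[R]_p)
    (theta a : 'rV[R]_p) (V : R) :
  (forall i, measurable_fun setT (fun x => F x 0 i)) ->
  (forall i, ('E_mu[(fun x => F x 0 i)%R] = (theta 0 i)%R%:E)%E) ->
  (\int[mu]_x (norm2 (F x - theta) ^+ 2)%:E <= V%:E)%E ->
  (\int[mu]_x (norm2 (F x - a) ^+ 2)%:E <= (V + norm2 (theta - a) ^+ 2)%:E)%E.
Proof.
move=> mF EF hV.
have mN : measurable_fun setT (fun x => (norm2 (F x - theta) ^+ 2)%:E).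
  by apply/measurable_EFinP; apply: measurable_funX; exact: measurable_norm2_dist.
have iN : mu.-integrable setT (fun x => (norm2 (F x - theta) ^+ 2)%:E).
  apply/integrableP; split => //.
  under eq_integral do rewrite gee0_abs ?lee_fin ?sqr_ge0//.
  exact: le_lt_trans hV (ltry _).
have icst (r : R) : mu.-integrable setT (fun=> r%:E).
  exact: finite_measure_integrable_cst.
have Icst (r : R) : (\int[mu]_x r%:E = r%:E)%E.
  by have := @expectation_cst _ _ _ mu r; rewrite unlock.
have iF i : mu.-integrable setT (fun x => (F x 0 i)%:E).
  (* Integrability of each coordinate follows from the finite second moment about [theta], through
     [|y| <= y^2 + 1] with [y = F x 0 i - theta 0 i]; that inequality comes from
     [(|y| - 1)^2 >= 0]. *)
  apply: (@le_integrable _ _ _ mu setT measurableT _ (fun x => (norm2 (F x - theta) ^+ 2)%:E + (1 + `|theta 0 i|)%:E)%E).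
  - exact/measurable_EFinP.
  - move=> x _; rewrite -EFinD !abse_EFin lee_fin.
    have := sqr_entry_le_norm2 _ _ (F x - theta) i; rewrite !mxE => h.
    have h0 := normr_ge0 (theta 0 i).
    rewrite [leRHS]ger0_norm; last by rewrite addr_ge0 ?sqr_ge0// addr_ge0.
    apply: (@le_trans _ _ (`|F x 0 i - theta 0 i| + `|theta 0 i|)).
      by rewrite -[X in `|X| <= _](subrK (theta 0 i)) ler_normD.
    rewrite addrA lerD2r.
    have := sqr_ge0 (`|F x 0 i - theta 0 i| - 1); rewrite sqrrB1 real_normK ?num_real//.
    have := sqr_ge0 (F x 0 i - theta 0 i).
    by move: h; rewrite mulr2n; lra.
  - exact: integrableD.
(* The [i]-th cross term in the expansion of the squared norm of [(F x - theta) + (theta - a)]. *)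
pose g i x : \bar R :=
  ((2 * (theta 0 i - a 0 i))%R%:E * ((F x 0 i)%R%:E + (- theta 0 i)%R%:E))%E.
have ig i : mu.-integrable setT (g i).
  by apply: integrableZl => //; exact: integrableD.
have g0 i : (\int[mu]_x g i x = 0)%E.
  rewrite integralZl//; last exact: integrableD.
  rewrite integralD// Icst.
  by have := EF i; rewrite unlock => ->; rewrite -EFinD subrr mule0.
have -> : (fun x => (norm2 (F x - a) ^+ 2)%:E) = (fun x =>
    ((norm2 (F x - theta) ^+ 2)%:E + \sum_(i < p) g i x)
    + (norm2 (theta - a) ^+ 2)%:E)%E.
  apply/funext => x; rewrite /g.
  under eq_bigr do rewrite -EFinD -EFinM.
  rewrite sumEFin -!EFinD !sqr_norm2 -!big_split/=; congr EFin.
  by apply: eq_bigr => i _; rewrite !mxE; ring.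
have iS : mu.-integrable setT (fun x => \sum_(i < p) g i x)%E by exact: integrable_sum.
rewrite integralD//; last exact: integrableD.
rewrite integralD// Icst EFinD leeD2r//.
rewrite integral_sum//; under eq_bigr do rewrite g0.
by rewrite big1// adde0.
Qed.

(** * Mean squared error of the estimator and along the training *)

Lemma estimator_second_moment_le (R : realType) (p : nat)
    (d : measure_display) (X : measurableType d)
    (Theta : set 'rV[R]_p) (P : 'rV[R]_p -> probability X R)
    (M : seq X -> 'rV[R]_p) (C1 C2 gamma kappa : R) :
  estimation_scheme Theta M -> gamma / 2 <= kappa ->
  uniform_tail Theta P M C1 C2 gamma (fun n => n%:R `^ kappa) ->
  exists2 K : R, 0 <= K & forall theta m, Theta theta -> (0 < m)%N ->
    (\int[iid_law (P theta) m]_x (norm2 (M x - theta) ^+ 2)%:E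
     <= (K / m%:R)%:E)%E.
Proof.
move=> [_ mM] Hkappa [C10 C20 g0 _ tail].
have [K K0 hK] := @second_moment_stretched_tail R C1 C2 gamma C10 C20 g0.
exists K => // theta m Th m0.
have m1 : 1 <= m%:R :> R by rewrite ler1n.
(* The scale of the error: [a^gamma = m^kappa] puts the tail assumption in the form
   [expR (- C2 (a delta)^gamma)]. *)
pose a : R := m%:R `^ (kappa / gamma).
have a0 : 0 < a by rewrite powR_gt0// ltr0n.
have ag : a `^ gamma = m%:R `^ kappa by rewrite -powRrM divfK ?gt_eqF.
apply: (@le_trans _ _ (K / a ^+ 2)%:E).
  apply: hK => //.
  - by apply: measurable_norm2_dist; exact: mM.
  - by move=> x; exact: norm2_ge0.
  - move=> delta delta0; rewrite ag; apply: le_trans (tail m delta m0 delta0).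
    by apply: ereal_sup_ubound; exists theta.
(* What remains is [m <= a^2 = m^(2 kappa / gamma)], where [gamma / 2 <= kappa] makes the exponent
   at least 1. *)
rewrite lee_fin ler_wpM2l// lef_pV2 ?posrE ?exprn_gt0 ?ltr0n//.
rewrite -powR_mulrn ?(ltW a0)// /a -powRrM -[leLHS]powRr1 ?ler0n// ler_powR//.
by rewrite mulrAC ler_pdivlMr// mul1r -ler_pdivrMr.
Qed.

Lemma past_measurable (R : realType) (d : measure_display)
    (X : measurableType d) (c : nat -> R) (n : nat)
    (dO : measure_display) (Omega : measurableType dO)
    (D : forall t, Omega -> (sample_size c n t).-tuple X) (t : nat) :
  (forall u, measurable_fun setT (D u)) -> past D t `<=` measurable.
Proof.
move=> mD; apply: smallest_sub; first exact: sigma_algebra_measurable.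
by move=> A [u _ [B mB <-]]; exact: mD.
Qed.

Lemma sample_size_ge (R : realType) (c : nat -> R) (n t : nat) : 0 <= c t ->
  (0 < t)%N -> c t * n%:R <= (sample_size c n t)%:R.
Proof.
move=> c0; case: t c0 => // t c0 _ /=.
have h : 0 <= c t.+1 * n%:R by rewrite mulr_ge0.
apply: (le_trans (ceil_ge _)).
by rewrite natr_absz ger0_norm// ceil_ge0 (lt_le_trans _ h)// ltrN10.
Qed.

(** The tower property reduces the claim to a fixed [w], where the sample has the law of i.i.d.
    draws from [P (theta t w)] and the bias-variance bound applies with mean [theta t w]. *)
Lemma training_step_second_moment (R : realType) (p : nat)
    (d : measure_display) (X : measurableType d)
    (Theta : set 'rV[R]_p) (P : 'rV[R]_p -> probability X R)
    (M : seq X -> 'rV[R]_p) (theta_star : 'rV[R]_p) (c : nat -> R) (n : nat)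
    (dO : measure_display) (Omega : measurableType dO)
    (Pr : probability Omega R)
    (D : forall t, Omega -> (sample_size c n t).-tuple X)
    (theta : nat -> Omega -> 'rV[R]_p) (t : nat) (K V : R) :
  estimation_scheme Theta M -> unbiased Theta P M ->
  recursive_training P M theta_star Pr D theta ->
  (forall th m, Theta th -> (0 < m)%N ->
    (\int[iid_law (P th) m]_x (norm2 (M x - th) ^+ 2)%:E <= (K / m%:R)%:E)%E) ->
  (0 < t)%N -> (0 < sample_size c n t)%N -> 0 <= K ->
  (\int[Pr]_w (norm2 (theta t w - theta_star) ^+ 2)%:E <= V%:E)%E ->
  (\int[Pr]_w (norm2 (theta t.+1 w - theta_star) ^+ 2)%:E
   <= (V + K / (sample_size c n t)%:R)%:E)%E.
Proof.
move=> [MT mM] unb [mD _ est step] hK t0 m0 K0 hV.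
set m := sample_size c n t in m0 *.
(* For [t > 0] the estimate is a value of [M]; [theta 0] is arbitrary. *)
have thT w : Theta (theta t w) by case: t t0 {hV m m0} => // u _; rewrite est.
have mth : measurable_fun setT (fun w => (norm2 (theta t w - theta_star) ^+ 2)%:E).
  apply/measurable_EFinP; apply: measurable_funX; apply: measurable_norm2_dist => i.
  case: t t0 {hV thT m m0} => // u _; under eq_fun do rewrite est.
  exact: (measurableT_comp (mM _ i) (mD u)).
have mh : measurable_fun setT (fun x : m.-tuple X => (norm2 (M x - theta_star) ^+ 2)%:E).
  apply/measurable_EFinP; apply: measurable_funX.
  by apply: measurable_norm2_dist; exact: mM.
have mk U : measurable U -> measurable_fun setT (fun w => iid_law (P (theta t w)) m U).
  (* Measurability of the kernel in [w] is inherited from the conditional probability, which is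
     measurable for the past. *)
  move=> mU _ B mB; rewrite setTI; apply: (past_measurable _ _ _ _ _ _ _ _ t mD).
  by have [+ _] := step t t0 U mU; apply.
under eq_integral do rewrite est.
rewrite (@integral_cond_law _ _ _ _ _ Pr (D t)
  (fun w => iid_law (P (theta t w)) m) _ (mD t) mk _ mh); last 2 first.
(* The defining identity of the conditional probability is used on the whole space, which belongs to
   the past as the complement of the empty set. *)
- move=> U mU; have [_ ->] := step t t0 U mU; first by rewrite setIT.
  by rewrite -setC0; apply: sigma_algebraC; exact: sigma_algebra0.
- by move=> x; rewrite lee_fin sqr_ge0.
apply: (@le_trans _ _ (\int[Pr]_w ((K / m%:R)%:E + (norm2 (theta t w - theta_star) ^+ 2)%:E))%E).
  apply: ge0_le_integral => //.
  - by move=> w _; apply: integral_ge0 => x _; rewrite lee_fin sqr_ge0.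
  - apply: measurable_fun_integral_kernel => //.
    by move=> z; rewrite lee_fin sqr_ge0.
  - exact: emeasurable_funD.
  - move=> w _; rewrite -EFinD; apply: second_moment_shift_le; last exact: hK.
    + exact: mM.
    + by move=> i; apply: unb.
rewrite ge0_integralD//; last 2 first.
- by move=> w _; rewrite lee_fin divr_ge0.
- by move=> w _; rewrite lee_fin sqr_ge0.
have := @expectation_cst _ _ _ Pr (K / m%:R); rewrite unlock => ->.
by rewrite (addrC V) EFinD leeD2l.
Qed.

Lemma training_second_moment_le (R : realType) (p : nat)
    (d : measure_display) (X : measurableType d)
    (Theta : set 'rV[R]_p) (P : 'rV[R]_p -> probability X R)
    (M : seq X -> 'rV[R]_p) (theta_star : 'rV[R]_p) (c : nat -> R) (n : nat)
    (dO : measure_display) (Omega : measurableType dO)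
    (Pr : probability Omega R)
    (D : forall t, Omega -> (sample_size c n t).-tuple X)
    (theta : nat -> Omega -> 'rV[R]_p) (s K : R) (t : nat) :
  estimation_scheme Theta M -> unbiased Theta P M ->
  recursive_training P M theta_star Pr D theta ->
  (forall th m, Theta th -> (0 < m)%N ->
    (\int[iid_law (P th) m]_x (norm2 (M x - th) ^+ 2)%:E <= (K / m%:R)%:E)%E) ->
  0 < s -> (forall u, (0 < u)%N -> c u = u%:R `^ (1 + s)) -> 0 <= K ->
  Theta theta_star -> (0 < n)%N ->
  (\int[Pr]_w (norm2 (theta t.+1 w - theta_star) ^+ 2)%:E
   <= (K / n%:R * (2 + s^-1))%:E)%E.
Proof.
move=> HM unb Htrain hK s0 hc K0 Hstar n0.
have nR : (0 : R) < n%:R by rewrite ltr0n.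
(* The 1 is the share of the initial sample of size [n]; each later generation [u] adds
   [u^(-(1+s))]. *)
suff H : (\int[Pr]_w (norm2 (theta t.+1 w - theta_star) ^+ 2)%:E
   <= (K / n%:R * (1 + \sum_(1 <= u < t.+1) (u%:R `^ (1 + s))^-1))%:E)%E.
  apply: le_trans H _; rewrite lee_fin ler_wpM2l ?divr_ge0 ?(ltW nR)//.
  have -> : 2 + s^-1 = 1 + (1 + s^-1) by ring.
  by rewrite lerD2l; exact: sum_powRN_le.
elim: t => [|t IH].
  rewrite big_geq// addr0 mulr1; apply: le_trans (hK _ _ Hstar n0).
  have [mD init est _] := Htrain; have [_ mM] := HM.
  under eq_integral do rewrite est.
  rewrite le_eqVlt; apply/orP; left; apply/eqP.
  (* The initial sample has a fixed law, so the tower property is applied to a constant kernel, and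
     the outer integral is that of a finite constant. *)
  rewrite (@integral_cond_law _ _ _ _ _ Pr (D 0%N) (fun=> iid_law (P theta_star) n)
    (fun x => (norm2 (M x - theta_star) ^+ 2)%:E) (mD 0%N)).
  - set I : \bar R := (\int[iid_law (P theta_star) n]_x _)%E.
    have I0 : (0 <= I)%E by apply: integral_ge0 => x _; rewrite lee_fin sqr_ge0.
    have Ioo : (I < +oo)%E := le_lt_trans (hK _ _ Hstar n0) (ltry _).
    have Ifin : I \is a fin_num by rewrite ge0_fin_numE.
    have := @expectation_cst _ _ _ Pr (fine I); rewrite unlock.
    by under eq_integral do rewrite fineK//; rewrite fineK.
  - by move=> U mU; exact: measurable_cst.
  - move=> U mU; rewrite init//.
    have := @expectation_cst _ _ _ Pr (fine (iid_law (P theta_star) n U)); rewrite unlock.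
    by under eq_integral do rewrite fineK ?fin_num_measure//; rewrite fineK ?fin_num_measure.
  - apply/measurable_EFinP; apply: measurable_funX.
    by apply: measurable_norm2_dist; exact: mM.
  - by move=> x; rewrite lee_fin sqr_ge0.
have c0 : 0 <= c t.+1 by rewrite hc// powR_ge0.
have cpos : 0 < c t.+1 * n%:R by rewrite mulr_gt0// hc// powR_gt0// ltr0n.
have szR := lt_le_trans cpos (sample_size_ge _ c n t.+1 c0 isT).
have sz0 : (0 < sample_size c n t.+1)%N by rewrite -(ltr0n R).
apply: le_trans (@training_step_second_moment R p d X Theta P M theta_star c n dO
  Omega Pr D theta t.+1 K _ HM unb Htrain hK isT sz0 K0 IH) _.
rewrite lee_fin [in leRHS]big_nat_recr//= addrA [leRHS]mulrDr lerD2l.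
(* Rounding the sample size up can only decrease the added error. *)
rewrite -mulrA ler_wpM2l// -invfM lef_pV2 ?posrE//; last first.
  by rewrite mulr_gt0// powR_gt0// ltr0n.
by rewrite mulrC -hc//; exact: (sample_size_ge _ c n t.+1).
Qed.

(** * Chebyshev's inequality and passage to the limit *)

Lemma norm2_tail_le (d : measure_display) (T : measurableType d)
    (R : realType) (mu : probability T R) (N : T -> R) (delta : R) :
  measurable_fun setT N -> (forall x, 0 <= N x) -> 0 < delta ->
  (mu [set x | (delta <= N x)%R] <=
   (delta ^- 2)%:E * \int[mu]_x (N x ^+ 2)%:E)%E.
Proof.
move=> mN N0 delta0.
have mA : measurable [set x | delta <= N x].
  by rewrite -[X in measurable X]setTI; exact: measurable_fun_le.
have d2 : 0 < delta ^+ 2 by exact: exprn_gt0.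
rewrite lee_pdivlMl// -[X in mu X]setIT -integral_indic//.
rewrite -ge0_integralZl ?lee_fin ?(ltW d2)//; last first.
  by apply/measurable_EFinP; exact: measurable_indic.
apply: ge0_le_integral => //.
- by move=> x _; rewrite -EFinM lee_fin mulr_ge0// ltW.
- by apply/measurable_EFinP; apply: measurable_funM => //; exact: measurable_indic.
- by apply/measurable_EFinP; exact: measurable_funX.
move=> x _; rewrite -EFinM lee_fin indicE.
have [/set_mem/= h|_] := boolP (x \in _); last by rewrite mulr0 sqr_ge0.
by rewrite mulr1 lerXn2r ?nnegrE ?(ltW delta0).
Qed.

(** The index 0 is left out because the process of estimates starts at time 1; the limsup is bounded
    by the supremum over positive indices. *)
Lemma limn_esup_le (R : realType) (u : (\bar R)^nat) (b : \bar R) :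
  (forall t, (u t.+1 <= b)%E) -> (limn_esup u <= b)%E.
Proof.
move=> ub; apply: (@le_trans _ _ (ereal_sup [set u x | x in [set t | (0 < t)%N]])).
  by apply: ereal_inf_lbound; exists [set t | (0 < t)%N] => //; exists 1%N.
by apply: ge_ereal_sup => _ [[|t] // _ <-].
Qed.

(* The inner limit over T need not exist under these hypotheses (a limit law
   of theta_T may charge the sphere of radius delta), so it is a limsup; where
   the inner limit exists, it equals that limsup. *)
Theorem theorem3 (R : realType) (p : nat)
    (d : measure_display) (X : measurableType d)
    (Theta : set 'rV[R]_p) (P : 'rV[R]_p -> probability X R)
    (M : seq X -> 'rV[R]_p) (HM : estimation_scheme Theta M)
    (C1 C2 gamma kappa : R) (Hkappa : gamma / 2 <= kappa)
    (Htail : uniform_tail Theta P M C1 C2 gamma (fun n => n%:R `^ kappa))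
    (Hunb : unbiased Theta P M)
    (s : R) (Hs : 0 < s)
    (c : nat -> R) (Hc : forall t, (0 < t)%N -> c t = t%:R `^ (1 + s))
    (theta_star : 'rV[R]_p) (Hstar : Theta theta_star)
    (dO : nat -> measure_display) (Omega : forall n, measurableType (dO n))
    (Pr : forall n, probability (Omega n) R)
    (D : forall n t, Omega n -> (sample_size c n t).-tuple X)
    (theta : forall n, nat -> Omega n -> 'rV[R]_p)
    (Htrain : forall n, (0 < n)%N ->
       recursive_training P M theta_star (Pr n) (D n) (theta n))
    (delta : R) (Hdelta : 0 < delta) :
  limn_esup (fun T : nat =>
      Pr n [set w | (delta <= norm2 (theta n T w - theta_star))%R])
    @[n --> \oo] --> 0%E.
Proof.
have [K K0 hK] := @estimator_second_moment_le R p d X Theta P M C1 C2 gamma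
  kappa HM Hkappa Htail.
(* Chebyshev's factor times the second-moment constant. [B] depends on neither [n] nor the
   generation, so the bound [B / n] survives the limsup over [T]. *)
pose B : R := delta ^- 2 * (K * (2 + s^-1)).
have bound n t : (0 < n)%N ->
    (Pr n [set w | (delta <= norm2 (theta n t.+1 w - theta_star))%R]
     <= (B * n%:R^-1)%:E)%E.
  move=> n0; have [mD _ est _] := Htrain n n0.
  apply: le_trans (@norm2_tail_le _ _ R (Pr n)
    (fun w => norm2 (theta n t.+1 w - theta_star)) delta _ _ Hdelta) _.
  - apply: measurable_norm2_dist => i; under eq_fun do rewrite est.
    exact: (measurableT_comp (HM.2 _ i) (mD t)).
  - by move=> w; exact: norm2_ge0.
  have -> : B * n%:R^-1 = delta ^- 2 * (K / n%:R * (2 + s^-1)) by rewrite /B; ring.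
  rewrite EFinM lee_wpmul2l//; first by rewrite lee_fin invr_ge0 exprn_ge0// ltW.
  exact: (@training_second_moment_le R p d X Theta P M theta_star c n _ _ (Pr n)
    (D n) (theta n) s K t HM Hunb (Htrain n n0) hK Hs Hc K0 Hstar n0).
apply: (@squeeze_cvge _ _ _ _ (cst 0%E) _ (fun n => (B * n%:R^-1)%:E)).
- near=> n; apply/andP; split.
    by apply: limf_esup_ge0 => // -[k _ /(_ k)]; apply => /=.
  by apply: limn_esup_le => t; apply: bound; near: n; exists 1%N.
- exact: cvg_cst.
- apply: cvg_EFin; first exact: nearW.
  rewrite -(mulr0 B); apply: cvgMr.
  (* The harmonic sequence is [1 / (n + 1)], hence the shift. *)
  by rewrite -cvg_shiftS; exact: cvg_harmonic.
Unshelve. all: by end_near. Qed.
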